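(* Let $(J,g)$ be a metallic Riemannian structure on a smooth manifold $M$ with $J^2=pJ+qI$, $p,q\in\mathbb R$, let $\nabla$ be a linear connection on $M$ with torsion $T^\nabla$, and let $\hat J_p:=\begin{pmatrix} J & (I-J^2)\sharp_g\\ \flat_g & -J^*\end{pmatrix}$ be the induced generalized product structure on $TM\oplus T^*M$, i.e. $\hat J_p(X+\alpha)=JX+(I-J^2)\sharp_g\alpha+\flat_g X-J^*\alpha$. Write $g$ also for $\flat_g$. Then $\hat J_p$ is $\nabla$-integrable if and only if the following six conditions hold for all $X,Y\in C^\infty(TM)$: (1) $N_J(X,Y)-(I-J^2)\sharp_g\big((d^\nabla g)(X,Y)\big)=0$; (2) $(\nabla_{JX}g)Y-(\nabla_{JY}g)X+J^*\big((\nabla_Xg)Y-(\nabla_Yg)X\big)+g\big((\nabla_YJ)X-(\nabla_XJ)Y\big)+g\big(T^\nabla(X,JY)+T^\nabla(JX,Y)\big)=0$; (3) $(d^\nabla g)((I-J^2)Y,X)-(\nabla_XJ^* )g(JY)+(\nabla_{JX}J^* )g(Y)=0$; (4) $(\nabla_{(I-J^2)X}J^* )g(Y)-(\nabla_{(I-J^2)Y}J^* )g(X)=0$; (5) $(\nabla_{(I-J^2)X}J^2)Y-(\nabla_{(I-J^2)Y}J^2)X+T^\nabla((I-J^2)X,(I-J^2)Y)+(I-J^2)\sharp_g\big((\nabla_{(I-J^2)X}g)Y-(\nabla_{(I-J^2)Y}g)X\big)=0$; (6) $-(\nabla_{JX}J^2)Y-(\nabla_{(I-J^2)Y}J)X+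(\nabla_XJ)Y+J(\nabla_XJ^2)Y-J^2(\nabla_XJ)Y-(I-J^2)\sharp_g\big((\nabla_{JX}g)Y-(\nabla_Xg)JY\big)-T^\nabla(JX,(I-J^2)Y)+JT^\nabla(X,(I-J^2)Y)=0$.
   Context: A metallic Riemannian structure $(J,g)$ on $M$ consists of a $(1,1)$-tensor field $J$ with $J^2=pJ+qI$ ($p,q\in\mathbb R$) and a Riemannian metric $g$ with $g(JX,Y)=g(X,JY)$. $\flat_g:TM\to T^*M$, $\flat_g(X):=i_Xg=g(X,\cdot)$, and $\sharp_g$ is its inverse; $(J^*\alpha)(X):=\alpha(JX)$. $N_J(X,Y):=[JX,JY]-J[JX,Y]-J[X,JY]+J^2[X,Y]$. $T^\nabla(X,Y):=\nabla_XY-\nabla_YX-[X,Y]$. For a vector field $X$, $\nabla_Xg$ is regarded as a map $TM\to T^*M$, i.e. $(\nabla_Xg)Y:=\nabla_X(\flat_gY)-\flat_g(\nabla_XY)$, and $(d^\nabla g)(X,Y):=(\nabla_Xg)(Y)-(\nabla_Yg)(X)+g(T^\nabla(X,Y))\in C^\infty(T^*M)$. A generalized product structure is an endomorphism of $TM\oplus T^*M$ with square $I$; $\hat J_p$ satisfies $\hat J_p^2=I$. The bracket on $C^\infty(TM\oplus T^*M)$ is $[X+\alpha,Y+\beta]_\nabla:=[X,Y]+\nabla_X\beta-\nabla_Y\alpha$. An endomorphism $\hat J$ of $TM\oplus T^*M$ is $\nabla$-integrable if $N^\nabla_{\hat J}(\sigma,\tau):=[\hat J\sigma,\hat J\tau]_\nabla-\hat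 J[\hat J\sigma,\tau]_\nabla-\hat J[\sigma,\hat J\tau]_\nabla+\hat J^2[\sigma,\tau]_\nabla$ vanishes for all $\sigma,\tau\in C^\infty(TM\oplus T^*M)$. *)

(* Defs.v *)
From HB Require Import structures.
From mathcomp Require Import all_boot all_order all_algebra.
From mathcomp Require Import all_classical all_reals.
From mathcomp Require Import topology normedtype derive.
From mathcomp Require Import ring.

Set Implicit Arguments.
Unset Strict Implicit.
Unset Printing Implicit Defensive.

Import Order.TTheory GRing.Theory Num.Theory.
Import numFieldNormedType.Exports.

Local Open Scope classical_set_scope.
Local Open Scope ring_scope.

Section Ck.
Variables (R : realType) (n : nat).
Implicit Types (V : set 'rV[R]_n) (f g : 'rV[R]_n -> R).

(* f is of class C^k on V, which is meant to be open: f and its iterated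
   partial derivatives of order <= k exist and are continuous on V. *)
Fixpoint Ck (k : nat) V f : Prop :=
  (forall x, V x -> {for x, continuous f}) /\
  (if k is k'.+1 then
     forall i : 'I_n,
       (forall x, V x -> derivable f x (delta_mx 0 i)) /\
       Ck k' V ('D_(delta_mx 0 i) f)
   else True).

Definition smooth_on V f := forall k, Ck k V f.

Lemma Ck_ext k V f g : open V -> (forall x, V x -> f x = g x) ->
  Ck k V f -> Ck k V g.
Proof.
move=> oV; elim: k f g => [|k IH] f g fg [cf df].
all: have fgn x (Vx : V x) : {near x, f =1 g}
  by near=> y; apply: fg; near: y; exact: oV.
all: split=> [x Vx|].
1,3: have := cf x Vx; rewrite /prop_for /continuous_at (fg x Vx);
  exact: (cvg_trans (near_eq_cvg (fgn x Vx))).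
- by [].
- move=> i; have [dfi Di] := df i; split=> [x Vx|].
    by apply: near_eq_derivable (dfi x Vx); exact: fgn.
  by apply: IH Di => x Vx; apply: near_eq_derive; exact: fgn.
Unshelve. all: by end_near. Qed.

Lemma CkW k V f : Ck k.+1 V f -> Ck k V f.
Proof.
elim: k f => [|k IH] f [cf df]; split=> // i.
by have [dfi Di] := df i; split=> //; apply: IH.
Qed.

Lemma Ck_cst k V (r : R) : Ck k V (cst r).
Proof.
elim: k r => [|k IH] r; split=> //; try by move=> x _; apply: cst_continuous.
move=> i; split=> [x _|]; first exact: derivable_cst.
have -> : 'D_(delta_mx 0 i) (cst r : 'rV[R]_n -> R) = cst 0.
  by apply/funext => x; rewrite derive_cst.
exact: IH.
Qed.

Lemma CkD k V f g : open V -> Ck k V f -> Ck k V g -> Ck k V (f + g).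
Proof.
move=> oV; elim: k f g => [|k IH] f g [cf df] [cg dg]; split=> //;
  try by move=> x Vx; apply: continuousD; [exact: cf|exact: cg].
move=> i; have [dfi Dfi] := df i; have [dgi Dgi] := dg i; split=> [x Vx|].
  by apply: derivableD; [exact: dfi|exact: dgi].
apply: Ck_ext (IH _ _ Dfi Dgi) => // x Vx.
by rewrite deriveD; [|exact: dfi|exact: dgi].
Qed.

Lemma CkM k V f g : open V -> Ck k V f -> Ck k V g -> Ck k V (f * g).
Proof.
move=> oV; elim: k f g => [|k IH] f g Hf Hg; have [cf df] := Hf;
  have [cg dg] := Hg; split=> //;
  try by move=> x Vx; apply: continuousM; [exact: cf|exact: cg].
move=> i; have [dfi Dfi] := df i; have [dgi Dgi] := dg i; split=> [x Vx|].
  by apply: derivableM; [exact: dfi|exact: dgi].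
have := CkD oV (IH _ _ (CkW Hf) Dgi) (IH _ _ (CkW Hg) Dfi).
apply: Ck_ext => // x Vx.
by rewrite deriveM; [|exact: dfi|exact: dgi].
Qed.

End Ck.

(* [chart_inv] is total, but only meaningful on [chart_coord @` chart_dom]. *)
Record chart (R : realType) (n : nat) (M : topologicalType) := Chart {
  chart_dom : set M;
  chart_coord : M -> 'rV[R]_n;
  chart_inv : 'rV[R]_n -> M;
  open_dom : open chart_dom;
  open_coord_dom : open (chart_coord @` chart_dom);
  coordK : forall x, chart_dom x -> chart_inv (chart_coord x) = x;
  coord_continuous : forall x, chart_dom x -> {for x, continuous chart_coord};
  invcoord_continuous :
    forall y, (chart_coord @` chart_dom) y -> {for y, continuous chart_inv} }.

Record smoothManifold (R : realType) (n : nat) := SmoothManifold {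
  carrier :> topologicalType;
  manifold_hausdorff : hausdorff_space carrier;
  manifold_second_countable : @second_countable carrier;
  atlas : set (chart R n carrier);
  atlas_cover : forall x, exists2 c, atlas c & chart_dom c x;
  atlas_compatible : forall c d, atlas c -> atlas d ->
    forall i : 'I_n,
      smooth_on (chart_coord c @` (chart_dom c `&` chart_dom d))
        (fun y => chart_coord d (chart_inv c y) 0 i) }.

Arguments atlas {R n} s.

Section smooth_functions.
Variables (R : realType) (n : nat) (M : smoothManifold R n).

Definition smooth (f : M -> R) : Prop :=
  forall c, atlas M c -> smooth_on (chart_coord c @` chart_dom c) (f \o chart_inv c).

Definition smoothp : {pred M -> R} := [pred f | `[< smooth f >]].

Lemma smooth_cst (r : R) : cst r \in smoothp.
Proof. by apply/asboolP => c _ k; exact: Ck_cst. Qed.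

Lemma smoothp_subring : subring_closed smoothp.
Proof.
have addS f g : f \in smoothp -> g \in smoothp -> f + g \in smoothp.
  move=> /asboolP sf /asboolP sg; apply/asboolP => c Ac k.
  by apply: CkD (sf c Ac k) (sg c Ac k); exact: open_coord_dom.
have mulS f g : f \in smoothp -> g \in smoothp -> f * g \in smoothp.
  move=> /asboolP sf /asboolP sg; apply/asboolP => c Ac k.
  by apply: CkM (sf c Ac k) (sg c Ac k); exact: open_coord_dom.
split=> [|f g sf sg|]; [exact: smooth_cst| |exact: mulS].
apply: addS => //.
have -> : - g = cst (-1) * g by apply/funext => x; rewrite !fctE mulN1r.
by apply: mulS => //; exact: smooth_cst.
Qed.

HB.instance Definition _ :=
  GRing.isSubringClosed.Build (M -> R) smoothp smoothp_subring.

Record smoothFun := SmoothFun {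
  smooth_val :> M -> R;
  smooth_valP : smooth_val \in smoothp }.

HB.instance Definition _ := [isSub for smooth_val].
HB.instance Definition _ := [Choice of smoothFun by <:].
HB.instance Definition _ :=
  GRing.SubChoice_isSubComPzRing.Build (M -> R) smoothp smoothFun smoothp_subring.

Definition cst_smooth (r : R) : smoothFun := SmoothFun (smooth_cst r).

End smooth_functions.

(* The tensor calculus is set up as in Helgason, Differential Geometry, Lie
   Groups, and Symmetric Spaces, Ch. I: a vector field is a derivation of the
   algebra C^oo(M), a 1-form is an element of the C^oo(M)-module dual to that
   of vector fields, and tensor fields are C^oo(M)-multilinear maps. *)

Section vector_fields.
Variables (R : realType) (n : nat) (M : smoothManifold R n).
Local Notation C := (smoothFun M).
Implicit Types (r : R) (f h : C).

Record vectorField := VectorField {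
  vf_fun :> C -> C;
  vf_linear : forall r f h,
    vf_fun (cst_smooth M r * f + h) = cst_smooth M r * vf_fun f + vf_fun h;
  vf_leibniz : forall f h, vf_fun (f * h) = vf_fun f * h + f * vf_fun h }.

Implicit Types X Y Z : vectorField.

Lemma vf_ext X Y : (forall f, X f = Y f) -> X = Y.
Proof.
case: X => x lx rx; case: Y => y ly ry /= /funext xy.
by case: _ / xy in ly ry *; congr VectorField; exact: Prop_irrelevance.
Qed.

Lemma cst_smooth1 : cst_smooth M 1 = 1.
Proof. exact: val_inj. Qed.

Lemma vfD X f h : X (f + h) = X f + X h.
Proof. by rewrite -[f in LHS]mul1r -cst_smooth1 vf_linear cst_smooth1 mul1r. Qed.

Lemma vf0 X : X 0 = 0.
Proof. by apply: (addrI (X 0)); rewrite -vfD !addr0. Qed.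

Lemma vfN X f : X (- f) = - X f.
Proof. by apply: (addrI (X f)); rewrite -vfD !subrr vf0. Qed.

Lemma vfB X f h : X (f - h) = X f - X h.
Proof. by rewrite vfD vfN. Qed.

Local Obligation Tactic := move=> *; rewrite /= ?(vf_linear, vf_leibniz); ring.

Program Definition vf_zero := @VectorField (fun=> 0) _ _.
Program Definition vf_add X Y := @VectorField (fun f => X f + Y f) _ _.
Program Definition vf_opp X := @VectorField (fun f => - X f) _ _.
Program Definition vf_scale f X := @VectorField (fun h => f * X h) _ _.

HB.instance Definition _ := gen_eqMixin vectorField.
HB.instance Definition _ := gen_choiceMixin vectorField.

Fact vf_addA : associative vf_add.
Proof. by move=> X Y Z; apply: vf_ext => f /=; rewrite addrA. Qed.
Fact vf_addC : commutative vf_add.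
Proof. by move=> X Y; apply: vf_ext => f /=; rewrite addrC. Qed.
Fact vf_add0 : left_id vf_zero vf_add.
Proof. by move=> X; apply: vf_ext => f /=; rewrite add0r. Qed.
Fact vf_addN : left_inverse vf_zero vf_opp vf_add.
Proof. by move=> X; apply: vf_ext => f /=; rewrite addNr. Qed.

HB.instance Definition _ :=
  GRing.isZmodule.Build vectorField vf_addA vf_addC vf_add0 vf_addN.

Fact vf_scaleA f h X : vf_scale f (vf_scale h X) = vf_scale (f * h) X.
Proof. by apply: vf_ext => k /=; rewrite mulrA. Qed.
Fact vf_scale1 : left_id 1 vf_scale.
Proof. by move=> X; apply: vf_ext => k /=; rewrite mul1r. Qed.
Fact vf_scaleDr : right_distributive vf_scale +%R.
Proof. by move=> f X Y; apply: vf_ext => k /=; rewrite mulrDr. Qed.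
Fact vf_scaleDl X : {morph vf_scale^~ X : f h / f + h}.
Proof. by move=> f h; apply: vf_ext => k /=; rewrite mulrDl. Qed.

HB.instance Definition _ := GRing.Zmodule_isLmodule.Build C vectorField
  vf_scaleA vf_scale1 vf_scaleDr vf_scaleDl.

Lemma vf_addE X Y f : (X + Y) f = X f + Y f. Proof. by []. Qed.
Lemma vf_oppE X f : (- X) f = - X f. Proof. by []. Qed.
Lemma vf_scaleE f X h : (f *: X) h = f * X h. Proof. by []. Qed.

Local Obligation Tactic :=
  move=> *; rewrite /= ?(vf_linear, vf_leibniz, vfD); ring.

Program Definition lie X Y := @VectorField (fun f => X (Y f) - Y (X f)) _ _.

End vector_fields.

Section one_forms.
Variables (R : realType) (n : nat) (M : smoothManifold R n).
Local Notation C := (smoothFun M).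
Local Notation VF := (vectorField M).
Implicit Types (f h : C) (X Y : VF).

Record oneForm := OneForm {
  form_fun :> VF -> C;
  oneForm_linear : forall f X Y,
    form_fun (f *: X + Y) = f * form_fun X + form_fun Y }.

Implicit Types alpha beta : oneForm.

Lemma oneForm_ext alpha beta : (forall X, alpha X = beta X) -> alpha = beta.
Proof.
case: alpha => a la; case: beta => b lb /= /funext ab.
by case: _ / ab in lb *; congr OneForm; exact: Prop_irrelevance.
Qed.

Lemma oneFormD alpha X Y : alpha (X + Y) = alpha X + alpha Y.
Proof. by rewrite -[X in LHS]scale1r oneForm_linear mul1r. Qed.

Lemma oneForm0 alpha : alpha 0 = 0.
Proof. by apply: (addrI (alpha 0)); rewrite -oneFormD !addr0. Qed.

Lemma oneFormZ alpha f X : alpha (f *: X) = f * alpha X.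
Proof. by rewrite -[f *: X]addr0 oneForm_linear oneForm0 addr0. Qed.

Lemma oneFormN alpha X : alpha (- X) = - alpha X.
Proof. by apply: (addrI (alpha X)); rewrite -oneFormD !subrr oneForm0. Qed.

Local Obligation Tactic := move=> *; rewrite /= ?oneForm_linear; ring.

Program Definition form_zero := @OneForm (fun=> 0) _.
Program Definition form_add alpha beta :=
  @OneForm (fun X => alpha X + beta X) _.
Program Definition form_opp alpha := @OneForm (fun X => - alpha X) _.
Program Definition form_scale f alpha := @OneForm (fun X => f * alpha X) _.

HB.instance Definition _ := gen_eqMixin oneForm.
HB.instance Definition _ := gen_choiceMixin oneForm.

Fact form_addA : associative form_add.
Proof. by move=> a b c; apply: oneForm_ext => X /=; rewrite addrA. Qed.
Fact form_addC : commutative form_add.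
Proof. by move=> a b; apply: oneForm_ext => X /=; rewrite addrC. Qed.
Fact form_add0 : left_id form_zero form_add.
Proof. by move=> a; apply: oneForm_ext => X /=; rewrite add0r. Qed.
Fact form_addN : left_inverse form_zero form_opp form_add.
Proof. by move=> a; apply: oneForm_ext => X /=; rewrite addNr. Qed.

HB.instance Definition _ :=
  GRing.isZmodule.Build oneForm form_addA form_addC form_add0 form_addN.

Fact form_scaleA f h alpha :
  form_scale f (form_scale h alpha) = form_scale (f * h) alpha.
Proof. by apply: oneForm_ext => X /=; rewrite mulrA. Qed.
Fact form_scale1 : left_id 1 form_scale.
Proof. by move=> a; apply: oneForm_ext => X /=; rewrite mul1r. Qed.
Fact form_scaleDr : right_distributive form_scale +%R.
Proof. by move=> f a b; apply: oneForm_ext => X /=; rewrite mulrDr. Qed.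
Fact form_scaleDl alpha : {morph form_scale^~ alpha : f h / f + h}.
Proof. by move=> f h; apply: oneForm_ext => X /=; rewrite mulrDl. Qed.

HB.instance Definition _ := GRing.Zmodule_isLmodule.Build C oneForm
  form_scaleA form_scale1 form_scaleDr form_scaleDl.

Lemma oneForm_addE alpha beta X : (alpha + beta) X = alpha X + beta X.
Proof. by []. Qed.
Lemma oneForm_oppE alpha X : (- alpha) X = - alpha X. Proof. by []. Qed.
Lemma oneForm_scaleE f alpha X : (f *: alpha) X = f * alpha X. Proof. by []. Qed.

End one_forms.

Section metallic.
Variables (R : realType) (n : nat) (M : smoothManifold R n).
Local Notation C := (smoothFun M).
Local Notation VF := (vectorField M).

(* X has a nonzero value at x iff it does not annihilate all functions at x. *)
Record riemannianMetric := RiemannianMetric {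
  riem_fun :> VF -> VF -> C;
  riem_linear : forall (X : VF) (f : C) (Y Z : VF),
    riem_fun X (f *: Y + Z) = f * riem_fun X Y + riem_fun X Z;
  riem_sym : forall X Y : VF, riem_fun X Y = riem_fun Y X;
  riem_pos : forall (X : VF) (x : M),
    (exists f : C, X f x != 0) -> 0 < riem_fun X X x }.

Definition flat (g : riemannianMetric) (X : VF) : oneForm M :=
  OneForm (@riem_linear g X).

Record connection := Connection {
  nabla_fun :> VF -> VF -> VF;
  nabla_linearl : forall (f : C) (X Y Z : VF),
    nabla_fun (f *: X + Y) Z = f *: nabla_fun X Z + nabla_fun Y Z;
  nablaDr : forall X Y Z : VF,
    nabla_fun X (Y + Z) = nabla_fun X Y + nabla_fun X Z;
  nabla_leibniz : forall (X : VF) (f : C) (Y : VF),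
    nabla_fun X (f *: Y) = X f *: Y + f *: nabla_fun X Y }.

Implicit Types (X Y : VF) (alpha beta : oneForm M) (D : connection).
Implicit Types (g : riemannianMetric) (J : {linear VF -> VF}).

Local Obligation Tactic := idtac.

Program Definition nabla_form D X alpha : oneForm M :=
  @OneForm _ _ _ (fun Y => X (alpha Y) - alpha (D X Y)) _.
Next Obligation.
move=> D X alpha f Y Z /=; rewrite nablaDr nabla_leibniz !(oneFormD, oneFormZ) vfD.
by rewrite vf_leibniz; ring.
Qed.

(* Covariant derivatives of a field of endomorphisms of TM, of a field of
   endomorphisms of T*M, and of g seen as a map TM -> T*M. *)
Definition nabla_end D X (F : VF -> VF) Y : VF := D X (F Y) - F (D X Y).
Definition nabla_coend D X (F : oneForm M -> oneForm M) alpha : oneForm M :=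
  nabla_form D X (F alpha) - F (nabla_form D X alpha).
Definition nabla_metric D X g Y : oneForm M :=
  nabla_form D X (flat g Y) - flat g (D X Y).

Definition torsion D X Y : VF := D X Y - D Y X - lie X Y.

Definition dnabla D g X Y : oneForm M :=
  nabla_metric D X g Y - nabla_metric D Y g X + flat g (torsion D X Y).

Definition nijenhuis J X Y : VF :=
  lie (J X) (J Y) - J (lie (J X) Y) - J (lie X (J Y)) + J (J (lie X Y)).

Definition metallic_riemannian (p q : R) J g :=
  (forall X, J (J X) = cst_smooth M p *: J X + cst_smooth M q *: X) /\
  (forall X Y, g (J X) Y = g X (J Y)).

Program Definition dual_end J alpha : oneForm M :=
  @OneForm _ _ _ (fun X => alpha (J X)) _.
Next Obligation. by move=> J alpha f X Y /=; rewrite linearP oneForm_linear. Qed.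

(* I - J^2 *)
Definition id_sub_sq J X : VF := X - J (J X).

(* X + alpha in C^oo(TM (+) T*M) is the pair (X, alpha). *)
Definition genSection : Type := (VF * oneForm M)%type.

Definition gen_bracket D (s t : genSection) : genSection :=
  (lie s.1 t.1, nabla_form D s.1 t.2 - nabla_form D t.1 s.2).

Definition nabla_integrable D (Phi : genSection -> genSection) :=
  forall s t : VF * oneForm M,
    gen_bracket D (Phi s) (Phi t) - Phi (gen_bracket D (Phi s) t)
    - Phi (gen_bracket D s (Phi t)) + Phi (Phi (gen_bracket D s t)) = 0.

Definition Jhat J g (sharp : oneForm M -> VF) (s : genSection) : genSection :=
  (J s.1 + id_sub_sq J (sharp s.2), flat g s.1 - dual_end J s.2).

End metallic.

(* Main.v *)
Require Import Defs.
From HB Require Import structures.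
From mathcomp Require Import all_boot all_order all_algebra.
From mathcomp Require Import all_classical all_reals.
From mathcomp Require Import topology normedtype derive.
From mathcomp Require Import ring.

Set Implicit Arguments.
Unset Strict Implicit.
Unset Printing Implicit Defensive.

Import Order.TTheory GRing.Theory Num.Theory.

Local Open Scope ring_scope.

(** The obstruction to integrability is
    N(s, t) = [Phi s, Phi t] - Phi [Phi s, t] - Phi [s, Phi t] + Phi^2 [s, t]
    for Phi := Jhat. The bracket of TM (+) T*M is biadditive and antisymmetric
    and Phi is additive, so N is biadditive and antisymmetric too. Since g is
    an isomorphism TM -> T*M, every section is X + g Y, and N vanishes
    identically iff it does on the pairs (X, Y), (X, gY) and (gX, gY) for all
    vector fields X, Y ([nabla_integrable_blocks]).

    Write K := I - J^2. The symmetry of J with respect to g turns J^* into J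
    across g (J^* g = g J), which gives Phi^2 = I and
    Phi X = JX + gX,   Phi (gY) = KY - g(JY).
    Each of the three restrictions of N therefore has an explicit vector part
    and an explicit form part, and these are, identically in X and Y and up to
    sign, the six expressions:
    N(X, Y) = ((1), (2)),   N(X, gY) = ((6), -(3)),   N(gX, gY) = (-(5), -(4)).
    The expressions of the theorem are written with tensors (torsion and the
    covariant derivatives of g, J, J^2, J^* ) while N involves only the Lie
    bracket and the covariant derivatives of forms; after expansion all the
    covariant derivatives of vector fields cancel, so these equalities are
    identities in an abelian group. *)

(** * Identities between vector fields and between 1-forms *)

Lemma vf_zeroE (R : realType) (n : nat) (M : smoothManifold R n)
  (f : smoothFun M) : (0 : vectorField M) f = 0.
Proof. by []. Qed.

Lemma oneForm_zeroE (R : realType) (n : nat) (M : smoothManifold R n)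
  (X : vectorField M) : (0 : oneForm M) X = 0.
Proof. by []. Qed.

(** Vector fields and 1-forms do not form rings, but evaluating at a function,
    respectively at a vector field, turns an identity of their additive groups
    into one of the commutative ring of smooth functions, which ring decides. *)
Ltac vf_group :=
  apply: vf_ext => ?; rewrite ?(vf_addE, vf_oppE, vf_zeroE); ring.
Ltac form_group :=
  apply: oneForm_ext => ?; rewrite ?(oneForm_addE, oneForm_oppE, oneForm_zeroE); ring.

(** * Additivity of the operations *)

Section Additivity.
Variables (R : realType) (n : nat) (M : smoothManifold R n).
Local Notation VF := (vectorField M).
Implicit Types (X Y Z : VF) (alpha beta : oneForm M).
Implicit Types (D : connection M) (g : riemannianMetric M) (J : {linear VF -> VF}).

Lemma lieC X Y : lie X Y = - lie Y X.
Proof. by apply: vf_ext => f; rewrite /lie /=; ring. Qed.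

Lemma lieDl X Y Z : lie (X + Y) Z = lie X Z + lie Y Z.
Proof. by apply: vf_ext => f; rewrite /= !vfD; ring. Qed.

Lemma lie0l X : lie 0 X = 0.
Proof. by apply: (addrI (lie 0 X)); rewrite -lieDl !addr0. Qed.

Lemma lie0r X : lie X 0 = 0.
Proof. by rewrite lieC lie0l oppr0. Qed.

Lemma nablaDl D X Y Z : D (X + Y) Z = D X Z + D Y Z.
Proof. by rewrite -[X in LHS]scale1r nabla_linearl scale1r. Qed.

Lemma nablaBr D X Y Z : D X (Y - Z) = D X Y - D X Z.
Proof. by apply/eqP; rewrite eq_sym subr_eq -nablaDr subrK. Qed.

Lemma nabla_formDl D X Y alpha :
  nabla_form D (X + Y) alpha = nabla_form D X alpha + nabla_form D Y alpha.
Proof.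
by apply: oneForm_ext => Z; rewrite oneForm_addE /= nablaDl oneFormD; ring.
Qed.

Lemma nabla_formD D X alpha beta :
  nabla_form D X (alpha + beta) = nabla_form D X alpha + nabla_form D X beta.
Proof.
by apply: oneForm_ext => Z; rewrite /= vfD; ring.
Qed.

Lemma nabla_form0l D alpha : nabla_form D 0 alpha = 0.
Proof. by apply: (addrI (nabla_form D 0 alpha)); rewrite -nabla_formDl !addr0. Qed.

Lemma nabla_form0 D X : nabla_form D X 0 = 0.
Proof. by apply: (addrI (nabla_form D X 0)); rewrite -nabla_formD !addr0. Qed.

Lemma nabla_formN D X alpha : nabla_form D X (- alpha) = - nabla_form D X alpha.
Proof.
by apply: oneForm_ext => Z; rewrite /= vfN; ring.
Qed.

Lemma nabla_formB D X alpha beta :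
  nabla_form D X (alpha - beta) = nabla_form D X alpha - nabla_form D X beta.
Proof. by rewrite nabla_formD nabla_formN. Qed.

Lemma flatD g X Y : flat g (X + Y) = flat g X + flat g Y.
Proof.
by apply: oneForm_ext => Z; rewrite oneForm_addE /= !(riem_sym _ _ Z) -[X in LHS]scale1r
  riem_linear mul1r.
Qed.

Lemma flat0 g : flat g 0 = 0.
Proof. by apply: (addrI (flat g 0)); rewrite -flatD !addr0. Qed.

Lemma flatB g X Y : flat g (X - Y) = flat g X - flat g Y.
Proof. by apply/eqP; rewrite eq_sym subr_eq -flatD subrK. Qed.

Lemma flatN g X : flat g (- X) = - flat g X.
Proof. by rewrite -[- X]sub0r flatB flat0 sub0r. Qed.

Lemma dual_endD J alpha beta :
  dual_end J (alpha + beta) = dual_end J alpha + dual_end J beta.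
Proof. exact: oneForm_ext. Qed.

Lemma dual_endN J alpha : dual_end J (- alpha) = - dual_end J alpha.
Proof. exact: oneForm_ext. Qed.

Lemma dual_endB J alpha beta :
  dual_end J (alpha - beta) = dual_end J alpha - dual_end J beta.
Proof. exact: oneForm_ext. Qed.

Lemma id_sub_sqE J X : id_sub_sq J X = X - J (J X).
Proof. by []. Qed.

Lemma nabla_id_sub_sq D J X Y :
  D X (id_sub_sq J Y) = D X Y - D X (J (J Y)).
Proof. exact: nablaBr. Qed.

Lemma id_sub_sq0 J : id_sub_sq J 0 = 0.
Proof. by rewrite /id_sub_sq !raddf0 addr0. Qed.

Lemma id_sub_sqD J X Y : id_sub_sq J (X + Y) = id_sub_sq J X + id_sub_sq J Y.
Proof. by rewrite /id_sub_sq !raddfD /=; vf_group. Qed.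

Lemma id_sub_sqB J X Y : id_sub_sq J (X - Y) = id_sub_sq J X - id_sub_sq J Y.
Proof. by rewrite /id_sub_sq !raddfB /=; vf_group. Qed.

Lemma id_sub_sqN J X : id_sub_sq J (- X) = - id_sub_sq J X.
Proof. by rewrite /id_sub_sq !raddfN /= opprD. Qed.

End Additivity.

(** * The Nijenhuis tensor of an additive operator on sections *)

Lemma pair_eq0 (U V : zmodType) (u : U) (v : V) :
  (u, v) = 0 :> U * V -> u = 0 /\ v = 0.
Proof. by move=> uv; split; [exact: (congr1 fst uv) | exact: (congr1 snd uv)]. Qed.

Section GeneralizedNijenhuis.
Variables (R : realType) (n : nat) (M : smoothManifold R n) (D : connection M).
Local Notation sec := (vectorField M * oneForm M)%type.
Implicit Types s t u : sec.

Lemma gen_bracketC s t : gen_bracket D s t = - gen_bracket D t s :> sec.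
Proof. by apply: injective_projections; rewrite /= ?opprB // lieC. Qed.

Lemma gen_bracketDl s t u :
  gen_bracket D (s + t) u = (gen_bracket D s u : sec) + gen_bracket D t u.
Proof.
apply: injective_projections => /=; first exact: lieDl.
by rewrite nabla_formDl nabla_formD; form_group.
Qed.

Variable Phi : sec -> sec.
Hypothesis PhiD : {morph Phi : s t / s + t}.

(** The value type is the explicit product, on which the group structure is
    inferred; the bracket is declared with values in an alias of it. *)
Definition gen_nijenhuis s t : sec :=
  gen_bracket D (Phi s) (Phi t) - Phi (gen_bracket D (Phi s) t)
  - Phi (gen_bracket D s (Phi t)) + Phi (Phi (gen_bracket D s t)).

Lemma PhiN : {morph Phi : s / - s}.
Proof.
have Phi0 : Phi 0 = 0 by apply: (addrI (Phi 0)); rewrite -PhiD !addr0.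
by move=> s; apply: (addrI (Phi s)); rewrite -PhiD !subrr.
Qed.

Lemma gen_nijenhuisC s t : gen_nijenhuis s t = - gen_nijenhuis t s.
Proof.
rewrite /gen_nijenhuis (gen_bracketC (Phi s)) (gen_bracketC (Phi s) t).
rewrite (gen_bracketC s (Phi t)) (gen_bracketC s t) !PhiN.
by rewrite !opprD !opprK; congr (_ + _); rewrite addrAC.
Qed.

Lemma gen_nijenhuisDl s t u :
  gen_nijenhuis (s + t) u = gen_nijenhuis s u + gen_nijenhuis t u.
Proof.
rewrite /gen_nijenhuis PhiD !gen_bracketDl !PhiD.
rewrite !opprD [RHS]addrACA; congr (_ + _); rewrite [RHS]addrACA.
by congr (_ + _); rewrite [RHS]addrACA.
Qed.

Lemma gen_nijenhuisDr s t u :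
  gen_nijenhuis s (t + u) = gen_nijenhuis s t + gen_nijenhuis s u.
Proof. by rewrite !(gen_nijenhuisC s) gen_nijenhuisDl opprD. Qed.

(** Since flat is surjective, any section splits as (X, 0) + (0, flat Y), and
    antisymmetry reduces the pairs (flat X, Y) to the pairs (Y, flat X). *)
Lemma nabla_integrable_blocks (flat : vectorField M -> oneForm M)
    (sharp : oneForm M -> vectorField M) (sharpK : cancel sharp flat) :
  nabla_integrable D Phi <->
  forall X Y, [/\ gen_nijenhuis (X, 0) (Y, 0) = 0,
                  gen_nijenhuis (X, 0) (0, flat Y) = 0 &
                  gen_nijenhuis (0, flat X) (0, flat Y) = 0].
Proof.
split=> [N0 X Y|N0 s t]; first by split; exact: N0.
have split_sec u : u = (u.1, 0) + (0, flat (sharp u.2)).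
  by apply: injective_projections; rewrite /= ?addr0 // add0r sharpK.
rewrite -/(gen_nijenhuis s t) (split_sec s) (split_sec t).
rewrite gen_nijenhuisDl !gen_nijenhuisDr.
rewrite (gen_nijenhuisC (0, _) (t.1, 0)).
have [-> _ _] := N0 s.1 t.1.
have [_ -> _] := N0 s.1 (sharp t.2).
have [_ -> _] := N0 t.1 (sharp s.2).
by have [_ _ ->] := N0 (sharp s.2) (sharp t.2); rewrite oppr0 !addr0.
Qed.

End GeneralizedNijenhuis.

(** * The three restrictions of the Nijenhuis tensor of Jhat *)

Section Blocks.
Variables (R : realType) (n : nat) (M : smoothManifold R n).
Variables (J : {linear vectorField M -> vectorField M}) (g : riemannianMetric M).
Variables (sharp : oneForm M -> vectorField M) (D : connection M).
Hypothesis (J_sym : forall X Y, g (J X) Y = g X (J Y)).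
Hypotheses (flatK : cancel (flat g) sharp) (sharpK : cancel sharp (flat g)).
Local Notation K := (id_sub_sq J).
Local Notation Js := (dual_end J).
Local Notation sec := (vectorField M * oneForm M)%type.
Implicit Types (X Y : vectorField M) (alpha beta : oneForm M).

Lemma sharpD alpha beta : sharp (alpha + beta) = sharp alpha + sharp beta.
Proof. by rewrite -[alpha]sharpK -[beta]sharpK -flatD !flatK. Qed.

Lemma sharpN alpha : sharp (- alpha) = - sharp alpha.
Proof. by rewrite -[alpha]sharpK -[- flat g _]sub0r -(flat0 g) -flatB !flatK sub0r. Qed.

Lemma sharpB alpha beta : sharp (alpha - beta) = sharp alpha - sharp beta.
Proof. by rewrite sharpD sharpN. Qed.

(** The symmetry of J with respect to g, read as J^* g = g J. *)
Lemma dual_end_flat X : Js (flat g X) = flat g (J X).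
Proof. by apply: oneForm_ext => Y /=; rewrite J_sym. Qed.

Lemma sharp_dual_end alpha : sharp (Js alpha) = J (sharp alpha).
Proof. by rewrite -[alpha in LHS]sharpK dual_end_flat flatK. Qed.

Lemma JhatD (s t : sec) :
  Jhat J g sharp (s + t) = (Jhat J g sharp s : sec) + Jhat J g sharp t.
Proof.
apply: injective_projections; rewrite /=.
  by rewrite raddfD sharpD id_sub_sqD /=; vf_group.
by rewrite flatD dual_endD; form_group.
Qed.

(** The off-diagonal blocks of the square cancel because J^* g = g J, and the
    diagonal ones give J^2 + (I - J^2) = I. The last term of the Nijenhuis
    tensor of Jhat is thus the bare bracket. *)
Lemma Jhat_involutive (s : sec) : Jhat J g sharp (Jhat J g sharp s) = s.
Proof.
apply: injective_projections; rewrite /=.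
  rewrite sharpD sharpN flatK sharp_dual_end id_sub_sqB raddfD /id_sub_sq !raddfB /=.
  by vf_group.
rewrite flatD dual_endD dual_endN dual_end_flat /id_sub_sq flatB.
rewrite -!dual_end_flat sharpK.
by form_group.
Qed.

Lemma Jhat_flat X Y :
  Jhat J g sharp (X, flat g Y) = (J X + K Y, flat g (X - J Y)).
Proof. by rewrite /Jhat /= flatK dual_end_flat flatB. Qed.

Lemma Jhat_vf X : Jhat J g sharp (X, 0) = (J X, flat g X).
Proof.
by rewrite -[X in (_, X)](flat0 g) Jhat_flat id_sub_sq0 addr0 raddf0 subr0.
Qed.

Lemma Jhat_form Y : Jhat J g sharp (0, flat g Y) = (K Y, - flat g (J Y)).
Proof. by rewrite Jhat_flat raddf0 add0r flatB flat0 sub0r. Qed.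

(** The torsion term is what makes d^nabla g independent of the covariant
    derivatives of vector fields: only the Lie bracket is left of it. *)
Lemma dnablaE X Y :
  dnabla D g X Y =
  nabla_form D X (flat g Y) - nabla_form D Y (flat g X) - flat g (lie X Y).
Proof. by rewrite /dnabla /nabla_metric /torsion !flatB; form_group. Qed.

Local Notation N := (gen_nijenhuis D (Jhat J g sharp)).

(** The last term of N(X, Y) is [X, Y] = J^2 [X, Y] + K [X, Y]: the first
    summand completes N_J, the second is the bracket term of
    - K sharp (d^nabla g)(X, Y), see [dnablaE]. *)
Lemma gen_nijenhuis_vf_vf X Y :
  N (X, 0) (Y, 0) =
  (nijenhuis J X Y - K (sharp (dnabla D g X Y)),
   nabla_metric D (J X) g Y - nabla_metric D (J Y) g X
     + Js (nabla_metric D X g Y - nabla_metric D Y g X)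
     + flat g (nabla_end D Y J X - nabla_end D X J Y)
     + flat g (torsion D X (J Y) + torsion D (J X) Y)).
Proof.
rewrite /gen_nijenhuis Jhat_involutive !Jhat_vf.
rewrite /gen_bracket /= !(nabla_form0, subr0, sub0r).
apply: injective_projections; rewrite /=.
  rewrite /nijenhuis dnablaE !sharpB !id_sub_sqB flatK sharpN.
  rewrite [K (lie _ _)]/id_sub_sq id_sub_sqN.
  by vf_group.
rewrite /nabla_metric /torsion /nabla_end.
rewrite !(flatB, flatD) !(dual_endB, dual_endN) !dual_end_flat.
by form_group.
Qed.

(** In the vector part, D_Z (KY) = D_Z Y - D_Z (J^2 Y) lets the torsion terms
    cancel the derivatives of J^2, for Z = JX and for Z = X. In the form part, the K in d^nabla g contributes a term in g(J^2 Y) that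
    cancels the one of (nabla_X J^* )(g(JY)). *)
Lemma gen_nijenhuis_vf_form X Y :
  N (X, 0) (0, flat g Y) =
  (- nabla_end D (J X) (J \o J) Y - nabla_end D (K Y) J X + nabla_end D X J Y
      + J (nabla_end D X (J \o J) Y) - (J \o J) (nabla_end D X J Y)
      - K (sharp (nabla_metric D (J X) g Y - nabla_metric D X g (J Y)))
      - torsion D (J X) (K Y) + J (torsion D X (K Y)),
   - (dnabla D g (K Y) X - nabla_coend D X Js (flat g (J Y))
      + nabla_coend D (J X) Js (flat g Y))).
Proof.
rewrite /gen_nijenhuis Jhat_involutive Jhat_vf Jhat_form.
rewrite /gen_bracket /= !(nabla_form0, nabla_form0l, lie0r, subr0).
apply: injective_projections; rewrite /=.
  rewrite /nabla_metric /torsion /nabla_end /= !(sharpB, sharpN, flatK).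
  rewrite !(id_sub_sqB, id_sub_sqN) nabla_formN sharpN id_sub_sqN.
  rewrite raddf0 add0r !nabla_id_sub_sq !(id_sub_sqE _ (D _ _)) !raddfB /=.
  by vf_group.
rewrite dnablaE /nabla_coend !nabla_formN !(dual_endB, dual_endN) !dual_end_flat.
rewrite [in RHS](lieC (K Y)) flatN flat0 (id_sub_sqE _ Y) flatB nabla_formB.
by form_group.
Qed.

(** Here [gX, gY] = 0, so no bracket survives except [KX, KY], which enters
    through the torsion. *)
Lemma gen_nijenhuis_form_form X Y :
  N (0, flat g X) (0, flat g Y) =
  (- (nabla_end D (K X) (J \o J) Y - nabla_end D (K Y) (J \o J) X
      + torsion D (K X) (K Y)
      + K (sharp (nabla_metric D (K X) g Y - nabla_metric D (K Y) g X))),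
   - (nabla_coend D (K X) Js (flat g Y) - nabla_coend D (K Y) Js (flat g X))).
Proof.
rewrite /gen_nijenhuis Jhat_involutive !Jhat_form.
rewrite /gen_bracket /= !(nabla_form0, nabla_form0l, lie0l, lie0r, subr0, sub0r).
apply: injective_projections; rewrite /=.
  rewrite /nabla_metric /torsion /nabla_end /= !(sharpB, sharpN, flatK).
  rewrite !(id_sub_sqB, id_sub_sqN) !nabla_id_sub_sq !(id_sub_sqE _ (D _ _)).
  rewrite !raddf0.
  by vf_group.
rewrite /nabla_coend !flat0 !nabla_formN !(dual_endB, dual_endN) !dual_end_flat.
by form_group.
Qed.

End Blocks.

Theorem proposition2p10 (R : realType) (n : nat) (M : smoothManifold R n)
    (p q : R) (J : {linear vectorField M -> vectorField M})
    (g : riemannianMetric M) (sharp : oneForm M -> vectorField M)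
    (D : connection M)
    (hJg : metallic_riemannian p q J g)
    (flatK : cancel (flat g) sharp) (sharpK : cancel sharp (flat g)) :
  let J2 := J \o J in
  let K := id_sub_sq J in
  let Js := dual_end J in
  nabla_integrable D (Jhat J g sharp) <->
  forall X Y : vectorField M,
    (* (1) *)
    nijenhuis J X Y - K (sharp (dnabla D g X Y)) = 0 /\
    (* (2) *)
    nabla_metric D (J X) g Y - nabla_metric D (J Y) g X
      + Js (nabla_metric D X g Y - nabla_metric D Y g X)
      + flat g (nabla_end D Y J X - nabla_end D X J Y)
      + flat g (torsion D X (J Y) + torsion D (J X) Y) = 0 /\
    (* (3) *)
    dnabla D g (K Y) X - nabla_coend D X Js (flat g (J Y))
      + nabla_coend D (J X) Js (flat g Y) = 0 /\
    (* (4) *)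
    nabla_coend D (K X) Js (flat g Y)
      - nabla_coend D (K Y) Js (flat g X) = 0 /\
    (* (5) *)
    nabla_end D (K X) J2 Y - nabla_end D (K Y) J2 X
      + torsion D (K X) (K Y)
      + K (sharp (nabla_metric D (K X) g Y - nabla_metric D (K Y) g X)) = 0 /\
    (* (6) *)
    - nabla_end D (J X) J2 Y - nabla_end D (K Y) J X + nabla_end D X J Y
      + J (nabla_end D X J2 Y) - J2 (nabla_end D X J Y)
      - K (sharp (nabla_metric D (J X) g Y - nabla_metric D X g (J Y)))
      - torsion D (J X) (K Y) + J (torsion D X (K Y)) = 0.
Proof.
move=> J2 K Js; rewrite /J2 /K /Js.
have [_ J_sym] := hJg.
rewrite (nabla_integrable_blocks D (JhatD J flatK sharpK) sharpK).
have blocks X Y := (gen_nijenhuis_vf_vf D J_sym flatK sharpK X Y,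
  gen_nijenhuis_vf_form D J_sym flatK sharpK X Y,
  gen_nijenhuis_form_form D J_sym flatK sharpK X Y).
split=> H X Y; have := H X Y; rewrite !blocks.
  case=> /pair_eq0[-> ->] /pair_eq0[-> /(canRL opprK) ->].
  by move=> /pair_eq0[/(canRL opprK) -> /(canRL opprK) ->]; rewrite !oppr0.
by move=> [-> [-> [-> [-> [-> ->]]]]]; rewrite !oppr0.
Qed.
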